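(* Assume that $\psi=-\lambda$ for some storage function $\lambda\in\mathcal{C}(\mathbb{X})$, i.e. a continuous $\lambda:\mathbb{X}\to\mathbb{R}$ with $\lambda(f(x,u))\le\lambda(x)+\ell(x,u)$ for all $(x,u)\in\mathbb{Z}$, and that the limit $$V^\psi_\infty(x)=\lim_{T\to+\infty}V^\psi_T(x)$$ exists and is finite for every $x\in\mathbb{X}$. Then $V^\psi_\infty$ is a lower semi-continuous solution of the Bellman Equation, i.e. $V^\psi_\infty$ is lower semi-continuous and $$\min_{u\in\mathbb{U}(x)}\big[\ell(x,u)+V^\psi_\infty(f(x,u))\big]=V^\psi_\infty(x)\qquad\forall\,x\in\mathbb{X}.$$
   Context: Setting. $\mathbb{X}\subset\mathbb{R}^n$ is a nonempty compact set, $\mathbb{Z}\subset\mathbb{X}\times\mathbb{R}^m$ is compact, $f:\mathbb{Z}\to\mathbb{X}$ and $\ell:\mathbb{Z}\to\mathbb{R}$ are continuous. For $x\in\mathbb{X}$, $\mathbb{U}(x):=\{u\in\mathbb{R}^m:(x,u)\in\mathbb{Z}\}$ is nonempty, and $f(x,u)\in\mathbb{X}$ for all $u\in\mathbb{U}(x)$; the set-valued map $\mathbb{U}(\cdot)$ is upper semicontinuous. $\mathcal{C}(\mathbb{X})$ is the set of continuous functions $\mathbb{X}\to\mathbb{R}$. It is a standing assumption that the Bellman operator $\psi\mapsto\big(x\mapsto\min_{u\in\mathbb{U}(x)}[\ell(x,u)+\psi(f(x,u))]\big)$ maps $\mathcal{C}(\mathbb{X})$ into $\mathcal{C}(\mathbb{X})$.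 For a continuous terminal cost $\psi:\mathbb{X}\to\mathbb{R}$ and a horizon $T\in\mathbb{N}$, the finite horizon optimal cost is $$V^\psi_T(x):=\min\Big\{\sum_{t=0}^{T-1}\ell(x(t),u(t))+\psi(x(T))\Big\},$$ the minimum being over all sequences with $x(0)=x$, $x(t+1)=f(x(t),u(t))$ and $(x(t),u(t))\in\mathbb{Z}$ for $t=0,\dots,T-1$, and $x(T)\in\mathbb{X}$. *)

(* Defs.v *)
From mathcomp Require Export all_boot all_order all_algebra.
From mathcomp Require Export all_classical all_reals all_analysis.

Set Implicit Arguments.
Unset Strict Implicit.
Unset Printing Implicit Defensive.

Import Order.TTheory GRing.Theory Num.Theory.
Import numFieldNormedType.Exports.

Local Open Scope classical_set_scope.
Local Open Scope ring_scope.

Section Minimum.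
Context {R : realType}.
Implicit Types (A : set R) (v : R).

Definition is_minimum A v := A v /\ lbound A v.

(* The junk value 0 is returned only when A has no least element. *)
Definition minimum A : R := xget 0 [set v | is_minimum A v].

Lemma is_minimum_unique A v w : is_minimum A v -> is_minimum A w -> v = w.
Proof. by move=> [Av lv] [Aw lw]; apply/le_anti; rewrite lv// lw. Qed.

Lemma minimumE A v : is_minimum A v -> minimum A = v.
Proof.
move=> Av; rewrite /minimum; case: xgetP => [w _ Aw|/(_ v)//].
exact: is_minimum_unique Aw Av.
Qed.

End Minimum.

Section OptimalControl.
Context {R : realType} {n m : nat}.

(* Functions on X or Z are total functions whose values off these sets are
   irrelevant; continuity is relative to X or Z. *)
Variables (X : set 'rV[R]_n) (Z : set ('rV[R]_n * 'rV[R]_m)%type).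
Variables (f : ('rV[R]_n * 'rV[R]_m)%type -> 'rV[R]_n).
Variables (ell : ('rV[R]_n * 'rV[R]_m)%type -> R).

Definition controls (x : 'rV[R]_n) : set 'rV[R]_m := [set u | Z (x, u)].

Definition usc_set_valued (U : 'rV[R]_n -> set 'rV[R]_m) :=
  forall x, X x -> forall O : set 'rV[R]_m, open O -> U x `<=` O ->
    \forall y \near within X (nbhs x), U y `<=` O.

Definition bellman_values (psi : 'rV[R]_n -> R) (x : 'rV[R]_n) : set R :=
  [set ell (x, u) + psi (f (x, u)) | u in controls x].

Definition bellman_operator (psi : 'rV[R]_n -> R) (x : 'rV[R]_n) : R :=
  minimum (bellman_values psi x).

(* Includes the assertion that the minimum is attained. *)
Definition bellman_solution (V : 'rV[R]_n -> R) :=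
  forall x, X x -> is_minimum (bellman_values V x) (V x).

(* Only xs 0, ..., xs T and us 0, ..., us (T - 1) are constrained. *)
Definition admissible (T : nat) (x : 'rV[R]_n)
    (xs : nat -> 'rV[R]_n) (us : nat -> 'rV[R]_m) :=
  [/\ xs 0%N = x,
      forall t, (t < T)%N -> xs t.+1 = f (xs t, us t),
      forall t, (t < T)%N -> Z (xs t, us t) &
      X (xs T)].

Definition trajectory_cost (psi : 'rV[R]_n -> R) (T : nat)
    (xs : nat -> 'rV[R]_n) (us : nat -> 'rV[R]_m) : R :=
  \sum_(t < T) ell (xs t, us t) + psi (xs T).

Definition optimal_cost (psi : 'rV[R]_n -> R) (T : nat) (x : 'rV[R]_n) : R :=
  minimum [set c | exists xs us,
    admissible T x xs us /\ c = trajectory_cost psi T xs us].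

Definition limit_cost (psi : 'rV[R]_n -> R) (x : 'rV[R]_n) : R :=
  lim (optimal_cost psi T x @[T --> \oo]).

Definition storage_function (lambda : 'rV[R]_n -> R) :=
  {within X, continuous lambda} /\
  forall x u, Z (x, u) -> lambda (f (x, u)) <= lambda x + ell (x, u).

End OptimalControl.

(* Semicontinuity relative to X is taken, as in {within X, continuous V}, for
   the subspace topology, in which the points outside X are isolated. *)
Definition lsc_within {R : realType} {n : nat} (X : set 'rV[R]_n)
    (V : 'rV[R]_n -> R) :=
  lower_semicontinuous (fun x : subspace X => (V x)%:E).

(* Main.v *)
Require Import Defs.
Import Order.TTheory GRing.Theory Num.Theory.
Import numFieldNormedType.Exports.
Local Open Scope classical_set_scope.
Local Open Scope ring_scope.

Set Implicit Arguments.
Unset Strict Implicit.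
Unset Printing Implicit Defensive.

(** Write [V T] for the optimal cost with horizon [T]. Dynamic programming
gives [V T.+1 x = min_u (ell (x, u) + V T (f (x, u)))]
([optimal_cost_recursion]); since the Bellman operator preserves continuity,
every [V T] is continuous on [X], so this minimum is attained.

With terminal cost [- lambda], the dissipation inequality of the storage
function [lambda] reads [- lambda x <= ell (x, u) - lambda (f (x, u))], that is,
[V 0 <= V 1] on [X]. The Bellman operator is monotone, so [V T] is nondecreasing
in [T] ([value_iteration_nondecreasing]) and its limit is a supremum of
continuous functions, hence lower semicontinuous ([lim_nondecreasing_lsc]).

In the Bellman equation for the limit [W], letting [T] grow in
[V T.+1 x <= ell (x, u) + V T (f (x, u))] shows that [W x] is a lower bound.
For attainment, the sets of controls [u] with
[ell (x, u) + V T (f (x, u)) <= W x] are nonempty, as they contain the optimal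
control for horizon [T.+1], they are compact, and they decrease with [T];
a control common to all of them ([compact_sublevel_seq]) satisfies
[ell (x, u) + W (f (x, u)) <= W x]. *)

(** * Compactness *)

(** A form of Cantor's intersection theorem: the sublevel sets of the [g k] form a
decreasing sequence of nonempty compact sets. The proof is the dual covering
argument: if every [z] had some [g k z > c], this strict inequality would spread
to a neighbourhood of [z] and to all later indices, so by compactness a single
[g N] would exceed [c] on all of [K]. *)
Lemma compact_sublevel_seq (R : realType) (T : topologicalType) (K : set T)
    (g : nat -> T -> R) (c : R) :
  compact K -> (forall k, {within K, continuous (g k)}) ->
  (forall z, K z -> nondecreasing_seq (g ^~ z)) ->
  (forall k, exists2 z, K z & g k z <= c) ->
  exists2 z, K z & forall k, g k z <= c.
Proof.
move=> /compact_near_coveringP/near_covering_withinP Kcov gcont gmono glec.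
apply: contrapT => noz.
have above z : K z -> exists k, c < g k z.
  move=> Kz; apply: contrapT => nok; apply: noz; exists z => // k.
  by rewrite leNgt; apply/negP => ck; apply: nok; exists k.
have [N _ /(_ N (leqnn N)) KN] : \forall N \near \oo,
    K `<=` [set z | c < g N z].
  apply: (Kcov nat \oo (fun N z => c < g N z)) => z Kz.
  have [k ck] := above z Kz.
  have /subspace_continuousP/(_ z Kz)/cvgr_gt/(_ c ck) := gcont k.
  rewrite near_withinE => near_z.
  exists ([set y | K y -> c < g k y], [set N | (k <= N)%N]) => /=.
    by split=> //; exists k.
  move=> [y N] /= [cy kN] Ky.
  exact: (lt_le_trans (cy Ky)) (gmono _ Ky _ _ kN).
have [z Kz] := glec N.
by rewrite leNgt KN.
Qed.

(** Minimizing over the controls at [x] is done on this slice of [Z], so that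
continuity of the costs relative to [Z] can be used as it stands. *)
Lemma compact_slice (U V : topologicalType) (Z : set (U * V)%type) (x : U) :
  hausdorff_space U -> compact Z -> compact (Z `&` [set z | z.1 = x]).
Proof.
move=> hU cZ.
have -> : [set z : U * V | z.1 = x] = fst @^-1` [set x] by [].
apply: compact_closedI => //; apply: closed_comp.
  by move=> z _; exact: cvg_fst.
exact/accessible_closed_set1/hausdorff_accessible.
Qed.

(** * Dynamic programming *)

Section DynamicProgramming.
Context (R : realType) (n m : nat) (X : set 'rV[R]_n)
  (Z : set ('rV[R]_n * 'rV[R]_m)%type)
  (f : ('rV[R]_n * 'rV[R]_m)%type -> 'rV[R]_n)
  (ell : ('rV[R]_n * 'rV[R]_m)%type -> R).
Hypothesis Z_compact : compact Z.
Hypothesis f_range : forall x u, X x -> controls Z x u -> X (f (x, u)).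
Hypothesis Z_sub : Z `<=` X `*` setT.
Hypothesis f_cont : {within Z, continuous f}.
Hypothesis ell_cont : {within Z, continuous ell}.
Hypothesis controls_neq0 : forall x, X x -> controls Z x !=set0.

Implicit Types (phi : 'rV[R]_n -> R) (x : 'rV[R]_n).

Lemma continuous_stage_value phi : {within X, continuous phi} ->
  {within Z, continuous (fun z => ell z + phi (f z))}.
Proof.
move=> phi_cont; apply: (within_continuousD (g := phi \o f)) => //.
apply/subspace_continuousP => -[x u] Zxu.
have fX z : Z z -> X (f z).
  by case: z => y v Zyv; apply: f_range => //; case: (Z_sub Zyv).
apply: (@cvg_comp _ _ _ f phi _ (within X (nbhs (f (x, u))))).
  move=> B; rewrite /within /= => nB.
  have /subspace_continuousP/(_ _ Zxu)/(_ _ nB) := f_cont.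
  rewrite !nbhs_simpl /within /=.
  by apply: filterS => z + Zz; apply => //; exact: fX.
by move/subspace_continuousP: phi_cont; apply; exact: fX.
Qed.

(** At points of [X], [minimum] in the Bellman operator is a true minimum: a
continuous cost attains its minimum on the slice of [Z] over [x]. *)
Lemma bellman_operator_minimum phi x : {within X, continuous phi} -> X x ->
  is_minimum (bellman_values Z f ell phi x) (bellman_operator Z f ell phi x).
Proof.
move=> phi_cont Xx.
suff [v vmin] : exists v, is_minimum (bellman_values Z f ell phi x) v.
  by rewrite /bellman_operator (minimumE vmin).
have [u0 Zxu0] := controls_neq0 Xx.
have [[y u] /set_mem[Zyu /= yx] umin] := compact_EVT_min
  (ex_intro _ (x, u0) (conj Zxu0 erefl))
  (compact_slice (x := x) (@norm_hausdorff _ _) Z_compact)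
  (continuous_subspaceW (@subIsetl _ _ _) (continuous_stage_value phi_cont)).
rewrite yx in Zyu umin.
exists (ell (x, u) + phi (f (x, u))); split; first by exists u.
move=> _ [v Zxv <-]; exact: (umin (x, v) (mem_set (conj Zxv erefl))).
Qed.

Definition admissible_costs phi (T : nat) x : set R :=
  [set c | exists xs us, admissible X Z f T x xs us /\
    c = trajectory_cost ell phi T xs us].

Lemma admissible_costs0_minimum phi x : X x ->
  is_minimum (admissible_costs phi 0 x) (phi x).
Proof.
move=> Xx; split.
  exists (fun=> x), (fun=> 0); split; first by split.
  by rewrite /trajectory_cost big_ord0 add0r.
move=> _ [xs [us [[xs0 _ _ _] ->]]].
by rewrite /trajectory_cost big_ord0 add0r xs0.
Qed.

(** The principle of optimality: the first stage splits off from the cost of a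
trajectory, and an admissible trajectory with [T.+1] steps is an admissible first
control followed by an admissible trajectory with [T] steps. *)
Lemma admissible_costsS_minimum phi (T : nat) (V : 'rV[R]_n -> R) x v :
  (forall y, X y -> is_minimum (admissible_costs phi T y) (V y)) -> X x ->
  is_minimum (bellman_values Z f ell V x) v ->
  is_minimum (admissible_costs phi T.+1 x) v.
Proof.
move=> Vmin Xx [[u Zxu <-] vmin].
have costS xs us : trajectory_cost ell phi T.+1 xs us =
    ell (xs 0%N, us 0%N) + trajectory_cost ell phi T (xs \o S) (us \o S).
  by rewrite /trajectory_cost big_ord_recl addrA.
split.
  have [[xs [us [[xs0 xsS Zxs XxT] ->]]] _] := Vmin _ (f_range Xx Zxu).
  pose xs' t := if t is s.+1 then xs s else x.
  pose us' t := if t is s.+1 then us s else u.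
  exists xs', us'; split; last by rewrite costS.
  by split=> // -[|t] //= ltT; [exact: xsS|exact: Zxs].
move=> _ [xs [us [[xs0 xsS Zxs XxT] ->]]].
rewrite costS; have := Zxs 0%N (ltn0Sn T); rewrite xs0 => Zx0.
apply: (le_trans (vmin _ (imageP _ Zx0))); rewrite lerD2l.
apply: (Vmin _ (f_range Xx Zx0)).2.
exists (xs \o S), (us \o S); split=> //; split=> //=.
- by rewrite xsS// xs0.
- by move=> t ltT; rewrite xsS.
- by move=> t ltT; exact: Zxs.
Qed.

(** Continuity and recursion have to be proved together: the minimum defining the
next cost is attained because the previous cost is continuous, and the next cost
is continuous because it is the Bellman operator applied to the previous one. *)
Lemma optimal_cost_recursion phi (T : nat) :
  (forall phi, {within X, continuous phi} ->
     {within X, continuous (bellman_operator Z f ell phi)}) ->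
  {within X, continuous phi} ->
  let V := optimal_cost X Z f ell phi in
  {within X, continuous (V T)} /\
  forall x, X x -> is_minimum (bellman_values Z f ell (V T) x) (V T.+1 x).
Proof.
move=> bellman_cont phi_cont V.
have stepE k x : {within X, continuous (V k)} ->
    (forall y, X y -> is_minimum (admissible_costs phi k y) (V k y)) ->
    X x -> V k.+1 x = bellman_operator Z f ell (V k) x.
  move=> Vcont Vmin Xx; apply/minimumE.
  by apply: admissible_costsS_minimum Vmin _ _ => //; exact: bellman_operator_minimum.
suff [Vcont Vmin] : {within X, continuous (V T)} /\
    forall y, X y -> is_minimum (admissible_costs phi T y) (V T y).
  split=> // x Xx; rewrite stepE//; exact: bellman_operator_minimum.
elim: T => [|T [Vcont Vmin]].
  have V0 x : X x -> V 0%N x = phi x.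
    by move=> Xx; apply/minimumE/admissible_costs0_minimum.
  split=> [|x Xx]; last by rewrite V0//; exact: admissible_costs0_minimum.
  by apply: subspace_eq_continuous phi_cont => x /set_mem Xx; exact/esym/V0.
split=> [|x Xx].
  apply: subspace_eq_continuous (bellman_cont _ Vcont) => x /set_mem Xx.
  exact/esym/stepE.
apply: admissible_costsS_minimum (Vmin) _ _ => //.
by rewrite stepE//; exact: bellman_operator_minimum.
Qed.

(** * Monotone limits of value iteration *)

Lemma value_iteration_nondecreasing (V : nat -> 'rV[R]_n -> R) :
  (forall k x, X x -> is_minimum (bellman_values Z f ell (V k) x) (V k.+1 x)) ->
  (forall x, X x -> V 0%N x <= V 1%N x) ->
  forall x, X x -> nondecreasing_seq (V ^~ x).
Proof.
move=> Vrec V01 x Xx; apply/nondecreasing_seqP => k; elim: k x Xx => [//|k IH] x Xx.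
have [[u Zxu <-] _] := Vrec k.+1 x Xx.
apply: le_trans ((Vrec k x Xx).2 _ (imageP _ Zxu)) _.
by rewrite lerD2l; apply/IH/f_range.
Qed.

(** Monotonicity of the iterates makes the limit commute with the minimum over
controls, which in general it does not. *)
Lemma lim_value_iteration_bellman (V : nat -> 'rV[R]_n -> R) :
  (forall k, {within X, continuous (V k)}) ->
  (forall k x, X x -> is_minimum (bellman_values Z f ell (V k) x) (V k.+1 x)) ->
  (forall x, X x -> nondecreasing_seq (V ^~ x)) ->
  (forall x, X x -> cvgn (V ^~ x)) ->
  bellman_solution X Z f ell (fun x => limn (V ^~ x)).
Proof.
move=> Vcont Vrec Vmono Vcvg x Xx; set Vlim := fun x => limn (V ^~ x).
have leVlim y k : X y -> V k y <= Vlim y.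
  by move=> Xy; apply: nondecreasing_cvgn_le; [exact: Vmono|exact: Vcvg].
have le_values u : controls Z x u -> Vlim x <= ell (x, u) + Vlim (f (x, u)).
  move=> Zxu; apply: limr_le; first exact: Vcvg.
  near=> k; apply: (@le_trans _ _ (V k.+1 x)); first exact: Vmono.
  apply: le_trans ((Vrec k x Xx).2 _ (imageP _ Zxu)) _.
  by rewrite lerD2l; apply: leVlim; exact: f_range.
split; last by move=> _ [u Zxu <-]; exact: le_values.
have [] := @compact_sublevel_seq _ _ (Z `&` [set z | z.1 = x])
  (fun k z => ell z + V k (f z)) (Vlim x).
- exact: compact_slice (@norm_hausdorff _ _) Z_compact.
- by move=> k; apply: continuous_subspaceW (continuous_stage_value (Vcont k)).
- move=> [y u] [Zxu /= yx] j k jk; rewrite lerD2l; apply: Vmono => //.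
  by apply: f_range; rewrite ?yx // -yx.
- move=> k; have [[u Zxu uE] _] := Vrec k x Xx.
  by exists (x, u) => //=; rewrite uE; exact: leVlim.
move=> [y u] [/= Zxu yx] le_lim; rewrite yx in Zxu le_lim.
exists u => //; apply/le_anti/andP; split; last exact: le_values.
rewrite -lerBrDl; apply: limr_le; first exact/Vcvg/f_range.
by near=> k; rewrite lerBrDl.
Unshelve. all: by end_near. Qed.

End DynamicProgramming.

Lemma lim_nondecreasing_lsc (R : realType) (n : nat) (X : set 'rV[R]_n)
    (V : nat -> 'rV[R]_n -> R) :
  (forall k, {within X, continuous (V k)}) ->
  (forall x, X x -> nondecreasing_seq (V ^~ x)) ->
  (forall x, X x -> cvgn (V ^~ x)) ->
  lsc_within X (fun x => limn (V ^~ x)).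
Proof.
move=> Vcont Vmono Vcvg x a; rewrite lte_fin => alim.
have [Xx|nXx] := pselect (X x); last first.
  (* A point outside [X] is isolated in the subspace topology. *)
  exists [set x]; last by move=> _ ->; rewrite lte_fin.
  by rewrite /nbhs /= -nbhs_subspace_out.
have [k ak] : exists k, a < V k x.
  apply: contrapT => nok; move: alim; apply/negP; rewrite -leNgt.
  apply: limr_le; first exact: Vcvg.
  by near=> k; rewrite leNgt; apply/negP => ak; apply: nok; exists k.
exists [set y | X y /\ a < V k y].
  have /subspace_continuousP/(_ x Xx)/cvgr_gt/(_ a ak) := Vcont k.
  rewrite /nbhs /= -nbhs_subspace_in// near_withinE /within /=.
  by apply: filterS => y aVy Xy; split=> //; exact: aVy.
move=> y [Xy aky]; rewrite lte_fin; apply: (lt_le_trans aky).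
by apply: (nondecreasing_cvgn_le (Vmono y Xy)); exact: Vcvg.
Unshelve. all: by end_near. Qed.

Theorem proposition2p2 (R : realType) (n m : nat)
    (X : set 'rV[R]_n) (Z : set ('rV[R]_n * 'rV[R]_m)%type)
    (f : ('rV[R]_n * 'rV[R]_m)%type -> 'rV[R]_n)
    (ell : ('rV[R]_n * 'rV[R]_m)%type -> R)
    (X_neq0 : X !=set0) (X_compact : compact X)
    (Z_compact : compact Z) (Z_sub : Z `<=` X `*` setT)
    (f_cont : {within Z, continuous f})
    (f_range : forall x u, X x -> controls Z x u -> X (f (x, u)))
    (ell_cont : {within Z, continuous ell})
    (controls_neq0 : forall x, X x -> controls Z x !=set0)
    (controls_usc : usc_set_valued X (controls Z))
    (bellman_cont : forall phi : 'rV[R]_n -> R, {within X, continuous phi} ->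
       {within X, continuous (bellman_operator Z f ell phi)})
    (psi lambda : 'rV[R]_n -> R)
    (lambda_storage : storage_function X Z f ell lambda)
    (psiE : forall x, X x -> psi x = - lambda x)
    (limit_exists : forall x, X x ->
       cvg (optimal_cost X Z f ell psi T x @[T --> \oo])) :
  lsc_within X (limit_cost X Z f ell psi) /\
  bellman_solution X Z f ell (limit_cost X Z f ell psi).
Proof.
have [lambda_cont dissipation] := lambda_storage.
have psi_cont : {within X, continuous psi}.
  apply: (@subspace_eq_continuous _ X _ (- lambda)).
    by move=> x /set_mem Xx; exact/esym/psiE.
  by move=> x; apply: continuousN; exact: lambda_cont.
pose V := optimal_cost X Z f ell psi.
have V_rec T := optimal_cost_recursion Z_compact f_range Z_sub f_cont ell_cont
  controls_neq0 T bellman_cont psi_cont.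
have V_cont T : {within X, continuous (V T)} := (V_rec T).1.
have V0 x : X x -> V 0%N x = psi x.
  by move=> Xx; apply/minimumE/admissible_costs0_minimum.
have V_mono := value_iteration_nondecreasing f_range (fun T => (V_rec T).2).
have {}V_mono x : X x -> nondecreasing_seq (V ^~ x).
  apply: V_mono => {}x Xx; have [[u Zxu <-] _] := (V_rec 0%N).2 x Xx.
  have Xfxu := f_range _ _ Xx Zxu.
  suff : V 0%N x <= ell (x, u) + V 0%N (f (x, u)) by [].
  by rewrite (V0 _ Xx) (V0 _ Xfxu) !psiE// lerBrDr addrC lerBlDl dissipation.
split.
  exact: lim_nondecreasing_lsc V_cont V_mono limit_exists.
exact: (lim_value_iteration_bellman Z_compact f_range Z_sub f_cont ell_cont
  V_cont (fun T => (V_rec T).2) V_mono limit_exists).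
Qed.
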